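(* Let $p>3$ be a prime and let $x\in\mathbb{Z}$. If $p\nmid x(x+1)(2x+1)$, then $$\sum_{k=0}^{p-1}(2k+1)^3P_k(2x+1)^4\equiv\frac{p}{4x(x+1)}-\frac{p^2}{4x(x+1)}\left(-\frac{(2x+1)^2\,q_p(2x+1)}{2x(x+1)}+6(x^2+x)+1\right)\pmod{p^3}.$$
   Context: $P_n$ denotes the $n$th Legendre polynomial, $P_n(t):=\sum_{k=0}^n\binom{n}{k}\binom{n+k}{k}\left(\frac{t-1}{2}\right)^k$. For an integer $a$ not divisible by $p$, $q_p(a):=(a^{p-1}-1)/p$ is the Fermat quotient. For rational numbers $u,v$, $u\equiv v\pmod{p^m}$ means that $u-v\in p^m\mathbb{Z}_{(p)}$, where $\mathbb{Z}_{(p)}$ is the ring of rationals with denominator not divisible by $p$. *)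

(* Defs.v *)
From mathcomp Require Import all_boot all_order all_algebra.
Set Implicit Arguments.
Unset Strict Implicit.
Unset Printing Implicit Defensive.
Import Order.TTheory GRing.Theory Num.Theory.
Local Open Scope ring_scope.

Definition legendre (n : nat) : {poly rat} :=
  \sum_(0 <= k < n.+1)
    ('C(n, k) * 'C(n + k, k))%N%:R *: (2^-1 *: ('X - 1)) ^+ k.

(* Rational-valued, hence total; an integer as soon as p is a prime that does
   not divide a. *)
Definition fermat_quotient (p : nat) (a : int) : rat :=
  (a ^+ p.-1 - 1)%:~R / p%:R.

(* Z_(p) inside rat; denq r is the positive denominator of r in lowest terms. *)
Definition Zloc (p : nat) : {pred rat} := [pred r : rat | ~~ (p %| denq r)%Z].

Definition eqmod_loc (p m : nat) (u v : rat) : Prop :=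
  exists2 w : rat, w \in Zloc p & u - v = p%:R ^+ m * w.

(* Main.v *)
Require Import Defs.
From mathcomp Require Import all_boot all_order all_algebra.
From mathcomp Require Import finfield.
From mathcomp Require Import ring lra zify.
Import Order.TTheory GRing.Theory Num.Theory.
Local Open Scope ring_scope.

(** Write [y = x(x+1)], [z = 4y] (so that [1 + z = (2x+1)^2]) and
[E_m(k) = C(k,m) C(k+m,m)], which is [shifted_coef k m]; thus
[P_k(2x+1) = \sum_m E_m(k) x^m].  As a polynomial in [k(k+1)], [E_m] is
[\prod_(0 < i <= m) (k(k+1) - i(i-1)) / m!^2], and these products obey the
linearization rule [E_i E_j = \sum_m C(i+j,m) C(m,i) C(m,j) E_m]
([shifted_coef_mul]).  Using it once gives
[P_k(2x+1)^2 = \sum_m E_m(k) C(2m,m) y^m] ([legendre_sqr]), and using it again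
gives [P_k(2x+1)^4 = \sum_m E_m(k) G_m] ([legendre_quartic]), where [G_m] is an
explicit double sum over [i, j] of products of central binomial coefficients
times [y^(i+j)].

The sums [\sum_(k < p) (2k+1)^3 E_m(k)] have a closed form
([sum_odd_cube_shifted_coef]) which modulo [p^3] may be replaced by
[(-1)^m p^2 w_m] with [w_m = 1/(m+1) - 4/(m+2)].  In the resulting sum over
[i, j, m] the terms with [i + j >= p] vanish modulo [p^3], because [p] divides
both [C(i+j,m)] and one of the two central binomial coefficients
([quartic_vanish]).  For [i + j = s < p] the sum over [m] is a finite difference
of order [s] of a polynomial of degree [s] divided by [m+1] or [m+2], hence has
a closed form ([alt_sum_lin_coef_weight]), and the remaining convolution over
[i + j = s] is elementary ([sum_central_bin_weight]).  Altogether the sum is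
[- p^2 \sum_(s < p) (-z)^s (1/2 + 1/(s+2))] modulo [p^3]
([quartic_weight_closed]).

The part [\sum_s (-z)^s] is geometric and is [1] modulo [p].  The other part is,
up to the factor [z^2] and boundary terms, the truncated logarithm
[\sum_(0 < r < p) (-z)^r / r], which modulo [p] is
[- ((1+z)^p - 1 - z^p) / p] ([truncated_log]).  The terms in [z^p / p] cancel,
and [(1+z)^p = (2x+1)^(2p)] brings in the Fermat quotient of [2x+1]
([truncated_sum_eval]). *)

(** * Linearizing products of [shifted_coef] *)

Definition shifted_coef (k m : nat) : nat := 'C(k, m) * 'C(k + m, m).

(** The coefficient of [shifted_coef k m] in [shifted_coef k i * shifted_coef k j]. *)
Definition lin_coef (i j m : nat) : nat := 'C(i + j, m) * 'C(m, i) * 'C(m, j).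

Lemma shifted_coef_small k m : (k < m)%N -> shifted_coef k m = 0%N.
Proof. by move=> h; rewrite /shifted_coef bin_small. Qed.

Lemma natrB_bin (n m : nat) :
  (m.+1%:R * 'C(n, m.+1)%:R = (n%:R - m%:R) * 'C(n, m)%:R :> rat).
Proof.
have [h|h] := leqP m n; last by rewrite !bin_small ?mulr0 // ltnW.
by rewrite -natrB // -!natrM mul_bin_left.
Qed.

Lemma bin_up (n m : nat) :
  ((n.+1%:R - m%:R) * 'C(n.+1, m)%:R = n.+1%:R * 'C(n, m)%:R :> rat).
Proof.
have [h|h] := leqP m n.+1; last by rewrite !bin_small ?mulr0 // ltnW.
by rewrite -natrB // -!natrM mul_bin_down.
Qed.

(** [shifted_coef k m] is the product of [k(k+1) - i(i-1)] over [0 < i <= m],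
    divided by [m!^2]; this is the step from one product to the next. *)
Lemma shifted_coefS (k m : nat) :
  m.+1%:R ^+ 2 * (shifted_coef k m.+1)%:R
  = (k%:R * (k%:R + 1) - m%:R * (m%:R + 1)) * (shifted_coef k m)%:R :> rat.
Proof.
rewrite /shifted_coef !natrM addnS.
have h1 := natrB_bin k m.
have h2 := mul_bin_diag (k + m).+1 m.
have {}h2 : m.+1%:R * 'C((k + m).+1, m.+1)%:R = (k + m).+1%:R * 'C(k + m, m)%:R :> rat.
  by rewrite -!natrM -mul_bin_diag.
transitivity ((m.+1%:R * 'C(k, m.+1)%:R) * (m.+1%:R * 'C((k + m).+1, m.+1)%:R) : rat).
  by ring.
rewrite h1 h2 -!natr1 natrD; ring.
Qed.

(** The recurrence for the coefficients that makes the linearization formula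
    pass from [j] to [j + 1]: multiplying [E_m] by [k(k+1) - j(j+1)] yields
    [(m+1)^2 E_(m+1) + (m(m+1) - j(j+1)) E_m]. *)
Lemma lin_coefS (i j m : nat) :
  j.+1%:R ^+ 2 * (lin_coef i j.+1 m.+1)%:R
  = m.+1%:R ^+ 2 * (lin_coef i j m)%:R
    + (m.+1%:R * (m.+1%:R + 1) - j%:R * (j%:R + 1)) * (lin_coef i j m.+1)%:R :> rat.
Proof.
rewrite /lin_coef !natrM addnS binS natrD.
have hs := natrB_bin (i + j) m; have hj := natrB_bin m.+1 j.
have hpi := bin_up m i; have hpj := bin_up m j.
move: hs hj hpi hpj; rewrite natrD.
set a := 'C(_, m)%:R; set b := 'C(_, m.+1)%:R.
set r := 'C(m.+1, i)%:R; set q := 'C(m.+1, j)%:R; set q' := 'C(m.+1, j.+1)%:R.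
set r0 := 'C(m, i)%:R; set q0 := 'C(m, j)%:R => hs hj hpi hpj.
transitivity (j.+1%:R * (b + a) * r * (j.+1%:R * q') : rat); first by ring.
rewrite hj.
transitivity (a * (m.+1%:R * r0) * (m.+1%:R * q0)
  + (m.+1%:R * (m.+1%:R + 1) - j%:R * (j%:R + 1)) * (b * r * q) : rat); last by ring.
rewrite -hpi -hpj.
have {}hs := congr1 (fun v => (m.+1%:R - j%:R) * r * q * v) hs.
rewrite -!natr1 /= in hs *; lra.
Qed.

Lemma lin_coef0 (i j : nat) :
  j.+1%:R ^+ 2 * (lin_coef i j.+1 0)%:R
  = - (j%:R * (j%:R + 1)) * (lin_coef i j 0)%:R :> rat.
Proof.
rewrite /lin_coef (bin_small (ltn0Sn j)) muln0 mulr0.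
by case: j => [|j]; rewrite ?mul0r ?oppr0 ?mul0r // (bin_small (ltn0Sn j)) muln0 mulr0.
Qed.

(** By induction on [j]: both sides are multiplied by [k(k+1) - j(j+1)], which
    turns [E_j] into [(j+1)^2 E_(j+1)] on the left, and on the right is absorbed
    by the recurrence of [lin_coef].  The summation bound may be any [n > k], since
    [E_m(k)] vanishes for [m > k]. *)
Lemma shifted_coef_mul (i j k n : nat) : (k < n)%N ->
  (shifted_coef k i)%:R * (shifted_coef k j)%:R
  = \sum_(0 <= m < n) (lin_coef i j m)%:R * (shifted_coef k m)%:R :> rat.
Proof.
move=> ltkn; elim: j => [|j IH].
  have E m : m != i -> lin_coef i 0 m = 0%N.
    rewrite /lin_coef addn0 bin0 muln1 neq_ltn => /orP[h|h].
      by rewrite (bin_small h) muln0.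
    by rewrite (bin_small h).
  have E1 : lin_coef i 0 i = 1%N by rewrite /lin_coef addn0 binn bin0.
  rewrite {2}/shifted_coef !bin0 mulr1.
  have [ltin|leni] := ltnP i n.
    rewrite (big_cat_nat (n := i)) //= 1?ltnW // [X in _ + X]big_ltn // E1 mul1r.
    rewrite !big_nat !big1 ?add0r ?addr0 // => m.
      by move=> /andP[h _]; rewrite E ?mul0r // neq_ltn h orbT.
    by move=> /andP[_ h]; rewrite E ?mul0r // neq_ltn h.
  rewrite shifted_coef_small ?(leq_trans ltkn) // big_nat big1 // => m /andP[_ h].
  by rewrite E ?mul0r // neq_ltn (leq_trans h).
have jn0 : (j.+1%:R ^+ 2 : rat) != 0 by rewrite expf_neq0 // pnatr_eq0.
apply: (mulfI jn0).
rewrite mulrCA shifted_coefS mulrCA IH !big_distrr /=.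
case: n ltkn {IH} => // n lekn.
pose v m : rat := (lin_coef i j m)%:R; pose e m : rat := (shifted_coef k m)%:R.
transitivity (\sum_(0 <= m < n.+1) (m.+1%:R ^+ 2 * v m * e m.+1
    + (m%:R * (m%:R + 1) - j%:R * (j%:R + 1)) * v m * e m)).
  apply: eq_bigr => m _; have := shifted_coefS k m; rewrite -/(e m) -/(e m.+1) -/(v m) => h.
  by have := congr1 (fun w => v m * w) h => /= {}h; lra.
rewrite big_split /= big_nat_recr //= {2}/e shifted_coef_small // mulr0 addr0.
rewrite [X in _ + X]big_nat_recl // [RHS]big_nat_recl // addrCA -big_split /=; congr (_ + _).
  by rewrite mulrA lin_coef0 -/(v 0) -/(e 0) mul0r sub0r.
by apply: eq_bigr => m _; rewrite mulrA lin_coefS [RHS]mulrDl.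
Qed.

Lemma shifted_coef_sqr (al : nat -> rat) (k n : nat) : (k < n)%N ->
  (\sum_(0 <= i < n) (shifted_coef k i)%:R * al i) ^+ 2
  = \sum_(0 <= m < n) (shifted_coef k m)%:R *
      (\sum_(0 <= i < n) \sum_(0 <= j < n) (lin_coef i j m)%:R * (al i * al j)).
Proof.
move=> ltkn; rewrite expr2 big_distrl /=.
transitivity (\sum_(0 <= i < n) \sum_(0 <= j < n) \sum_(0 <= m < n)
   (shifted_coef k m)%:R * ((lin_coef i j m)%:R * (al i * al j))).
  apply: eq_bigr => i _; rewrite big_distrr /=; apply: eq_bigr => j _.
  rewrite mulrACA (shifted_coef_mul _ _ _ n) // big_distrl /=.
  by apply: eq_bigr => m _; ring.
rewrite exchange_big_nat /=.
under eq_bigr => j _ do rewrite exchange_big_nat.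
rewrite exchange_big_nat /=; apply: eq_bigr => m _.
rewrite exchange_big_nat /= big_distrr; apply: eq_bigr => j _ /=.
by rewrite big_distrr.
Qed.

Lemma coef_affine_exp (a b : rat) (n m : nat) :
  ((a%:P + b *: 'X) ^+ n)`_m = 'C(n, m)%:R * a ^+ (n - m) * b ^+ m.
Proof.
rewrite exprDn coef_sum.
have E (i : nat) : ((a%:P ^+ (n - i) * (b *: 'X) ^+ i) *+ 'C(n, i))`_m
    = (i == m)%:R * ('C(n, m)%:R * a ^+ (n - m) * b ^+ m).
  rewrite coefMn exprZn -polyC_exp coefCM coefZ coefXn eq_sym.
  rewrite -[LHS]mulr_natl; case: eqP => [->|_]; last by rewrite mulr0n !mulr0 mul0r.
  by rewrite mulr1 mul1r mulrA.
under eq_bigr => i _ do rewrite E.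
have [h|h] := leqP m n.
  rewrite (bigD1 (inord m)) //= inordK ?ltnS // eqxx mul1r big1 ?addr0 // => i /eqP ne.
  by case: eqP => [e|_]; [case: ne; rewrite -e inord_val|rewrite mul0r].
by rewrite bin_small // !mul0r big1 // => i _; rewrite mulr0.
Qed.

(** The left side is the coefficient of [X^m] in [(1 + t(1+X))^m (1 + t(1+X))^m],
    each factor being expanded in powers of [1 + X]; the right side reads the same
    coefficient off [((1+t) + tX)^(2m)]. *)
Lemma sum_lin_coef_expr (t : rat) (m n : nat) : (m < n)%N ->
  \sum_(0 <= i < n) \sum_(0 <= j < n) (lin_coef i j m)%:R * (t ^+ i * t ^+ j)
  = 'C(2 * m, m)%:R * (t * (t + 1)) ^+ m.
Proof.
move=> ltmn.
pose u : {poly rat} := 'X + 1.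
have E : (t *: u + 1) ^+ m = \sum_(0 <= i < n) ('C(m, i)%:R * t ^+ i) *: u ^+ i.
  rewrite addrC exprDn -(big_mkord xpredT (fun i => (1 ^+ (m - i) * (t *: u) ^+ i) *+ 'C(m, i))).
  rewrite (big_cat_nat (n := m.+1) (p := n)) //= [X in _ + X]big_nat [X in _ + X]big1 ?addr0.
    by apply: eq_bigr => i _; rewrite expr1n mul1r exprZn -scaler_nat scalerA.
  by move=> i /andP[h _]; rewrite bin_small // mul0r scale0r.
have affE : t *: u + 1 = (t + 1)%:P + t *: 'X.
  by rewrite /u scalerDr -addrA addrC polyCD alg_polyC.
transitivity (((t + 1)%:P + t *: 'X) ^+ (m + m))`_m; last first.
  by rewrite coef_affine_exp addnK -mulrA -exprMn (mulrC (t + 1)) addnn -mul2n.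
rewrite -affE exprD E big_distrl /= coef_sum; apply: eq_bigr => i _.
rewrite big_distrr /= coef_sum; apply: eq_bigr => j _.
rewrite -scalerAl -scalerAr scalerA coefZ -(exprD u).
rewrite (_ : u = 1%:P + 1 *: ('X : {poly rat})); last by rewrite scale1r addrC.
by rewrite coef_affine_exp !expr1n !mulr1 /lin_coef !natrM; ring.
Qed.

(** * Fourth powers of Legendre polynomials and their weighted sums *)

Lemma legendre_shifted (t : rat) (k n : nat) : (k < n)%N ->
  (legendre k).[2 * t + 1] = \sum_(0 <= i < n) (shifted_coef k i)%:R * t ^+ i.
Proof.
move=> ltkn; rewrite /legendre horner_sum.
rewrite [RHS](big_cat_nat (n := k.+1)) //= [X in _ = _ + X]big_nat [X in _ = _ + X]big1 ?addr0.
  apply: eq_bigr => i _; rewrite hornerZ horner_exp hornerZ !hornerE.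
  by congr (_ * _ ^+ _); field.
by move=> i /andP[h _]; rewrite shifted_coef_small ?mul0r.
Qed.

Lemma legendre_sqr (t : rat) (k n : nat) : (k < n)%N ->
  (legendre k).[2 * t + 1] ^+ 2
  = \sum_(0 <= m < n)
      (shifted_coef k m)%:R * ('C(2 * m, m)%:R * (t * (t + 1)) ^+ m).
Proof.
move=> ltkn; rewrite (legendre_shifted t _ _ ltkn) shifted_coef_sqr //.
by apply: eq_big_nat => m /andP[_ h]; rewrite sum_lin_coef_expr.
Qed.

(** The coefficient [G_m] of [shifted_coef k m] in [P_k(2t+1)^4], for
    [y = t(t+1)]; it does not depend on [k] as long as [k < n]. *)
Definition quartic_coef (n : nat) (y : rat) (m : nat) : rat :=
  \sum_(0 <= i < n) \sum_(0 <= j < n) (lin_coef i j m)%:R *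
    ('C(2 * i, i)%:R * y ^+ i * ('C(2 * j, j)%:R * y ^+ j)).

Lemma legendre_quartic (t : rat) (k n : nat) : (k < n)%N ->
  (legendre k).[2 * t + 1] ^+ 4
  = \sum_(0 <= m < n) (shifted_coef k m)%:R * quartic_coef n (t * (t + 1)) m.
Proof.
move=> ltkn; rewrite (exprM _ 2 2) (legendre_sqr t _ _ ltkn).
by rewrite (shifted_coef_sqr (fun i => 'C(2 * i, i)%:R * (t * (t + 1)) ^+ i)).
Qed.

(** The step from [n] to [n + 1] in the telescoping sum below. *)
Lemma shifted_coef_next (n m : nat) :
  (n.+1%:R - m%:R) * (shifted_coef n.+1 m)%:R
  = (n.+1%:R + m%:R) * (shifted_coef n m)%:R :> rat.
Proof.
rewrite /shifted_coef !natrM.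
have h1 := bin_up n m; have h2 := bin_up (n + m) m.
rewrite addSn.
have n0 : (n.+1%:R : rat) != 0 by rewrite pnatr_eq0.
have {}h2 : n.+1%:R * 'C((n + m).+1, m)%:R = (n.+1%:R + m%:R) * 'C(n + m, m)%:R :> rat.
  by move: h2; rewrite -!natr1 natrD => h2; rewrite -[RHS]addr0; lra.
apply: (mulfI n0); rewrite [LHS]mulrCA.
transitivity (((n.+1%:R - m%:R) * 'C(n.+1, m)%:R) * (n.+1%:R * 'C((n + m).+1, m)%:R) : rat).
  by ring.
by rewrite h1 h2; ring.
Qed.

Lemma sum_odd_shifted_coef (n m : nat) :
  \sum_(0 <= k < n) (2 * k + 1)%N%:R * (shifted_coef k m)%:R
  = n%:R * (n%:R - m%:R) * (shifted_coef n m)%:R / m.+1%:R :> rat.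
Proof.
have m0 : (m.+1%:R : rat) != 0 by rewrite pnatr_eq0.
elim: n => [|n IH]; first by rewrite big_nil !mul0r.
rewrite big_nat_recr //= IH -[n.+1%:R * _ * _]mulrA shifted_coef_next.
by rewrite natrD natrM -!natr1; field; rewrite natr1.
Qed.

(** Since [(2k+1)^2 = 4k(k+1) + 1], the product [(2k+1)^2 E_m] equals
    [4(m+1)^2 E_(m+1) + (2m+1)^2 E_m], which reduces the cube to the sums with
    weight [2k+1]. *)
Lemma sum_odd_cube_shifted_coef (n m : nat) :
  \sum_(0 <= k < n) (2 * k + 1)%N%:R ^+ 3 * (shifted_coef k m)%:R
  = n%:R * (n%:R - m%:R) * (shifted_coef n m)%:R *
     (m.+1%:R^-1 - 4 / m.+2%:R + 4 * n%:R ^+ 2 / m.+2%:R) :> rat.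
Proof.
have m0 : (m.+1%:R : rat) != 0 by rewrite pnatr_eq0.
have m1 : (m.+2%:R : rat) != 0 by rewrite pnatr_eq0.
transitivity (4 * (m.+1%:R ^+ 2 *
    \sum_(0 <= k < n) (2 * k + 1)%N%:R * (shifted_coef k m.+1)%:R)
  + (2 * m%:R + 1) ^+ 2 * \sum_(0 <= k < n) (2 * k + 1)%N%:R * (shifted_coef k m)%:R : rat).
  rewrite !big_distrr /= -big_split /=; apply: eq_bigr => k _.
  rewrite [_ ^+ 2 * (_ * _)]mulrCA shifted_coefS natrD natrM; ring.
rewrite !sum_odd_shifted_coef.
rewrite [X in 4 * X](_ : _ = n%:R * (n%:R - m.+1%:R) *
  (m.+1%:R ^+ 2 * (shifted_coef n m.+1)%:R) / m.+2%:R); last by ring.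
by rewrite shifted_coefS -!natr1 in m0 m1 *; field; rewrite m0 m1.
Qed.

Lemma sum_legendre_quartic (t : rat) (n : nat) :
  \sum_(0 <= k < n) (2 * k + 1)%N%:R ^+ 3 * (legendre k).[2 * t + 1] ^+ 4
  = \sum_(0 <= m < n) n%:R * (n%:R - m%:R) * (shifted_coef n m)%:R *
     (m.+1%:R^-1 - 4 / m.+2%:R + 4 * n%:R ^+ 2 / m.+2%:R)
     * quartic_coef n (t * (t + 1)) m.
Proof.
under eq_big_nat => k /andP[_ h] do
  rewrite (legendre_quartic t _ _ h) big_distrr /=.
rewrite exchange_big_nat /=; apply: eq_bigr => m _.
rewrite -sum_odd_cube_shifted_coef big_distrl /=.
by apply: eq_bigr => k _; rewrite mulrA.
Qed.

(** * Alternating sums against polynomials *)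

(** The [s]-th finite difference kills polynomials of degree below [s].  In the
    induction, [R] is split as a constant plus a multiple of ['X - (s+1)], and
    [(s+1-m) C(s+1,m) = (s+1) C(s,m)] lowers the order of the difference. *)
Lemma alt_sum_poly (s : nat) (R : {poly rat}) : (size R <= s)%N ->
  \sum_(0 <= m < s.+1) (-1) ^+ m * 'C(s, m)%:R * R.[m%:R] = 0.
Proof.
elim: s R => [|s IH] R.
  by rewrite leqn0 size_poly_eq0 => /eqP ->; rewrite big1 // => m _; rewrite horner0 mulr0.
move=> sR.
have [R1 E] : exists R1, R = (R.[s.+1%:R])%:P + R1 * ('X - (s.+1%:R)%:P).
  have /factor_theorem[R1 E] : root (R - (R.[s.+1%:R])%:P) s.+1%:R.
    by rewrite /root !hornerE subrr.
  by exists R1; rewrite -E addrC subrK.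
have sR1 : (size R1 <= s)%N.
  have [->|nz] := eqVneq R1 0; first by rewrite size_poly0.
  have : (size (R1 * ('X - (s.+1%:R)%:P))%R <= s.+1)%N.
    have -> : R1 * ('X - (s.+1%:R)%:P) = R - (R.[s.+1%:R])%:P
      by apply/eqP; rewrite eq_sym subr_eq addrC; apply/eqP.
    rewrite (leq_trans (size_polyD _ _)) // geq_max sR size_polyN.
    by rewrite (leq_trans (size_polyC_leq1 _)).
  by rewrite size_Mmonic ?monicXsubC // size_XsubC addn2.
rewrite E.
transitivity (R.[s.+1%:R] * (\sum_(0 <= m < s.+2) (-1) ^+ m * 'C(s.+1, m)%:R)
   - s.+1%:R * \sum_(0 <= m < s.+1) (-1) ^+ m * 'C(s, m)%:R * R1.[m%:R]).
  rewrite [RHS]addrC big_distrr /= -sumrN.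
  have -> F : \sum_(0 <= m < s.+1) F m
      = \sum_(0 <= m < s.+2) if (m < s.+1)%N then F m else 0 :> rat.
    rewrite [RHS]big_nat_recr //= ltnn addr0; apply: eq_big_nat => m /andP[_ h].
    by rewrite h.
  rewrite big_distrr /= -big_split /=; apply: eq_big_nat => m /andP[_ h].
  rewrite !hornerE; have b := bin_up s m.
  have {}b : s.+1%:R * (if (m < s.+1)%N then 'C(s, m)%:R else 0)
      = (s.+1%:R - m%:R) * 'C(s.+1, m)%:R :> rat.
    by rewrite b; case: ltnP => // h1; rewrite bin_small.
  have {}b := congr1 (fun x => (-1) ^+ m * R1.[m%:R] * x) b => /=.
  by case: ltnP b => h1 b; lra.
rewrite IH // mulr0 subr0.
have -> : \sum_(0 <= m < s.+2) (-1) ^+ m * 'C(s.+1, m)%:R = (1 - 1) ^+ s.+1 :> rat.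
  rewrite exprDn big_mkord; apply: eq_bigr => m _.
  by rewrite expr1n mul1r mulr_natr.
by rewrite subrr expr0n mulr0.
Qed.

(** Modulo ['X + (a+1)] the polynomial [Q] is the constant [Q.[-(a+1)]]; the
    quotient has degree below [s], so its finite difference vanishes. *)
Lemma alt_sum_poly_div (s a : nat) (Q : {poly rat}) : (size Q <= s.+1)%N ->
  \sum_(0 <= m < s.+1) (-1) ^+ m * 'C(s, m)%:R * Q.[m%:R] / (m + a.+1)%N%:R
  = Q.[- a.+1%:R] *
    \sum_(0 <= m < s.+1) (-1) ^+ m * 'C(s, m)%:R / (m + a.+1)%N%:R.
Proof.
move=> sQ; set c := - a.+1%:R.
have [R E] : exists R, Q = (Q.[c])%:P + R * ('X - c%:P).
  have /factor_theorem[R E] : root (Q - (Q.[c])%:P) c.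
    by rewrite /root !hornerE subrr.
  by exists R; rewrite -E addrC subrK.
have sR : (size R <= s)%N.
  have [->|nz] := eqVneq R 0; first by rewrite size_poly0.
  have : (size (R * ('X - c%:P))%R <= s.+1)%N.
    have -> : R * ('X - c%:P) = Q - (Q.[c])%:P
      by apply/eqP; rewrite eq_sym subr_eq addrC; apply/eqP.
    rewrite (leq_trans (size_polyD _ _)) // geq_max sQ size_polyN.
    by rewrite (leq_trans (size_polyC_leq1 _)).
  by rewrite size_Mmonic ?monicXsubC // size_XsubC addn2.
have Z := alt_sum_poly _ _ sR.
rewrite -[RHS]addr0 -[X in _ = _ + X]Z big_distrr /= -big_split /=.
apply: eq_bigr => m _; rewrite {1}E !hornerE natrD /c /=.
have n0 : (m%:R + a.+1%:R : rat) != 0 by rewrite -natrD pnatr_eq0 addnS.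
by field; rewrite nat1r.
Qed.

(** By Pascal's rule, raising [s] by one replaces the sum by its difference with
    the sum in which [b] is raised by one. *)
Lemma alt_sum_inv_shift (s b : nat) :
  \sum_(0 <= m < s.+1) (-1) ^+ m * 'C(s, m)%:R / (m + b.+1)%N%:R
  = s`!%:R * b`!%:R / (s + b).+1`!%:R :> rat.
Proof.
elim: s b => [|s IH] b.
  rewrite big_nat1 bin0 expr0 !mul1r add0n factS natrM invfM.
  by rewrite mulrCA mulfV ?mulr1 // pnatr_eq0 -lt0n fact_gt0.
transitivity (\sum_(0 <= m < s.+1) (-1) ^+ m * 'C(s, m)%:R / (m + b.+1)%N%:R
  - \sum_(0 <= m < s.+1) (-1) ^+ m * 'C(s, m)%:R / (m + b.+2)%N%:R : rat).
  rewrite big_nat_recl //= [in RHS]big_nat_recl //= -addrA; congr (_ + _).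
    by rewrite !bin0.
  have -> F : \sum_(0 <= i < s) F i = \sum_(0 <= i < s.+1) F i - F s :> rat.
    by rewrite big_nat_recr //= addrK.
  rewrite [in RHS](bin_small (ltnSn s)) mulr0 mul0r subr0 -sumrN -big_split /=.
  apply: eq_bigr => m _; rewrite binS natrD exprS addSnnS.
  by ring.
rewrite !IH addSn addnS !factS !natrM -!natr1 natrD.
have f0 : ((s + b)`!%:R : rat) != 0 by rewrite pnatr_eq0 -lt0n fact_gt0.
have h1 : (s%:R + b%:R + 1 : rat) != 0 by rewrite -natrD natr1 pnatr_eq0.
have h2 : (s%:R + b%:R + 1 + 1 : rat) != 0 by rewrite -natrD !natr1 pnatr_eq0.
by field; rewrite f0 h1 h2.
Qed.

Definition bin_poly (i : nat) : {poly rat} :=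
  (i`!%:R)^-1 *: \prod_(0 <= l < i) ('X - l%:R%:P).

Lemma bin_polyE (i m : nat) : (bin_poly i).[m%:R] = 'C(m, i)%:R.
Proof.
have f0 (k : nat) : (k`!%:R : rat) != 0 by rewrite pnatr_eq0 -lt0n fact_gt0.
rewrite /bin_poly; elim: i => [|i IH].
  by rewrite big_nil bin0 hornerZ hornerC mulr1 invr1.
have h := natrB_bin m i.
rewrite big_nat_recr //=; move: IH; rewrite !hornerZ hornerM hornerXsubC => IH.
rewrite mulrA factS natrM invfM -[X in X * _]mulrA IH.
have n0 : (i.+1%:R : rat) != 0 by rewrite pnatr_eq0.
by apply: (mulfI n0); rewrite h; field; rewrite nat1r.
Qed.

Lemma bin_poly_neg (i a : nat) :
  (bin_poly i).[- a.+1%:R] = (-1) ^+ i * 'C(i + a, i)%:R.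
Proof.
rewrite /bin_poly; elim: i => [|i IH].
  by rewrite big_nil hornerZ hornerC bin0 expr0 invr1 !mulr1.
rewrite big_nat_recr //=; move: IH; rewrite !hornerZ hornerM hornerXsubC => IH.
rewrite mulrA factS natrM invfM -[X in X * _]mulrA IH.
have n0 : (i.+1%:R : rat) != 0 by rewrite pnatr_eq0.
have h : i.+1%:R * 'C((i + a).+1, i.+1)%:R = (i + a).+1%:R * 'C(i + a, i)%:R :> rat.
  by rewrite -!natrM -mul_bin_diag.
apply: (mulfI n0); rewrite addSn exprS [RHS]mulrCA [X in _ * X]mulrC h.
by rewrite -!natr1 natrD in n0 *; field.
Qed.

Lemma size_bin_poly (i : nat) : (size (bin_poly i) <= i.+1)%N.
Proof.
rewrite /bin_poly (leq_trans (size_scale_leq _ _)) //.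
by rewrite size_prod_XsubC size_iota subn0.
Qed.

(** [C(m,i) C(m,j)] is a polynomial of degree [i + j] in [m], so only its value at
    [m = -(a+1)] matters. *)
Lemma alt_sum_lin_coef (i j a n : nat) : (i + j < n)%N ->
  \sum_(0 <= m < n) (-1) ^+ m * (lin_coef i j m)%:R / (m + a.+1)%N%:R
  = (-1) ^+ (i + j) * ('C(i + a, i) * 'C(j + a, j))%N%:R *
    ((i + j)`!%:R * a`!%:R / (i + j + a).+1`!%:R) :> rat.
Proof.
move=> lt_ijn.
rewrite (big_cat_nat (n := (i + j).+1)) //= [X in _ + X]big_nat [X in _ + X]big1 ?addr0; last first.
  by move=> m /andP[h _]; rewrite /lin_coef bin_small // mulr0 mul0r.
have sQ : (size (bin_poly i * bin_poly j)%R <= (i + j).+1)%N.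
  apply: leq_trans (size_polyMleq _ _) _.
  have := leq_add (size_bin_poly i) (size_bin_poly j); lia.
have := alt_sum_poly_div (i + j) a _ sQ.
rewrite alt_sum_inv_shift hornerM !bin_poly_neg natrM => h.
transitivity ((-1) ^+ i * 'C(i + a, i)%:R * ((-1) ^+ j * 'C(j + a, j)%:R) *
  ((i + j)`!%:R * a`!%:R / (i + j + a).+1`!%:R) : rat); last by rewrite exprD; ring.
rewrite -h; apply: eq_bigr => m _; rewrite hornerM !bin_polyE /lin_coef !natrM; ring.
Qed.

Lemma alt_sum_lin_coef_weight (i j n : nat) : (i + j < n)%N ->
  \sum_(0 <= m < n) (-1) ^+ m * (lin_coef i j m)%:R * (m.+1%:R^-1 - 4 / m.+2%:R)
  = (-1) ^+ (i + j) * ((i + j).+1%:R^-1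
      - 4 * (i.+1%:R * j.+1%:R) / ((i + j).+1%:R * (i + j).+2%:R)) :> rat.
Proof.
move=> h.
have h0 := alt_sum_lin_coef _ _ 0 _ h; have h1 := alt_sum_lin_coef _ _ 1 _ h.
transitivity (\sum_(0 <= m < n) (-1) ^+ m * (lin_coef i j m)%:R / (m + 1)%N%:R
  - 4 * \sum_(0 <= m < n) (-1) ^+ m * (lin_coef i j m)%:R / (m + 2)%N%:R : rat).
  rewrite big_distrr /= -sumrN -big_split /=; apply: eq_bigr => m _.
  by rewrite addn1 addn2; ring.
rewrite h0 h1 !addn0 !addn1 !binn !binSn !factS !natrM !mulr1.
have f0 : ((i + j)`!%:R : rat) != 0 by rewrite pnatr_eq0 -lt0n fact_gt0.
by field; rewrite f0 -!natrD !nat1r !pnatr_eq0.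
Qed.

(** * Convolutions of central binomial coefficients *)

Lemma central_binS (n : nat) :
  n.+1%:R * 'C(2 * n.+1, n.+1)%:R = (4 * n%:R + 2) * 'C(2 * n, n)%:R :> rat.
Proof.
have h1 : n.+1%:R * 'C((2 * n).+2, n.+1)%:R = (2 * n).+2%:R * 'C((2 * n).+1, n)%:R :> rat.
  by rewrite -!natrM -mul_bin_diag.
have h2 := bin_up (2 * n) n.
have -> : (2 * n.+1 = (2 * n).+2)%N by lia.
have n0 : (n.+1%:R : rat) != 0 by rewrite pnatr_eq0.
apply: (mulfI n0); rewrite h1.
transitivity (2 * n.+1%:R * (((2 * n).+1%:R - n%:R) * 'C((2 * n).+1, n)%:R) : rat).
  by rewrite -!natr1 natrM; ring.
by rewrite h2 -!natr1 natrM; ring.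
Qed.

Lemma sum_rev_index (f : nat -> nat -> rat) (s : nat) :
  \sum_(0 <= i < s.+1) f i (s - i)%N = \sum_(0 <= i < s.+1) f (s - i)%N i.
Proof.
rewrite big_nat_rev /= add0n; apply: eq_big_nat => i /andP[_ h].
by rewrite subSS subKn.
Qed.

Definition central_bin (i : nat) : rat := 'C(2 * i, i)%:R.

(** The symmetry [i <-> s - i] makes the average of [i] equal to [s/2]. *)
Lemma sum_central_bin_mull (s : nat) :
  \sum_(0 <= i < s.+1) i%:R * (central_bin i * central_bin (s - i))
  = s%:R / 2 * \sum_(0 <= i < s.+1) central_bin i * central_bin (s - i).
Proof.
have h : \sum_(0 <= i < s.+1) i%:R * (central_bin i * central_bin (s - i))
       = \sum_(0 <= i < s.+1) (s - i)%:R * (central_bin i * central_bin (s - i)).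
  rewrite (sum_rev_index (fun i j => i%:R * (central_bin i * central_bin j))).
  by apply: eq_bigr => i _; rewrite [central_bin i * _]mulrC.
have : \sum_(0 <= i < s.+1) i%:R * (central_bin i * central_bin (s - i))
   + \sum_(0 <= i < s.+1) (s - i)%:R * (central_bin i * central_bin (s - i))
   = s%:R * \sum_(0 <= i < s.+1) central_bin i * central_bin (s - i).
  rewrite -big_split /= big_distrr; apply: eq_big_nat => i /andP[_ hi].
  by rewrite -mulrDl -natrD subnKC.
by rewrite -h => ?; lra.
Qed.

(** The coefficient identity of [(1-4X)^(-1/2) (1-4X)^(-1/2) = (1-4X)^(-1)],
    obtained from the first-order recurrence of the central binomials. *)
Lemma sum_central_bin (s : nat) :
  \sum_(0 <= i < s.+1) central_bin i * central_bin (s - i) = 4 ^+ s.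
Proof.
elim: s => [|s IH]; first by rewrite big_nat1.
have n0 : (s.+1%:R : rat) != 0 by rewrite pnatr_eq0.
have := sum_central_bin_mull s.+1.
rewrite big_nat_recl //= mul0r add0r => h.
have {h} : \sum_(0 <= i < s.+1) (4 * i%:R + 2) * (central_bin i * central_bin (s - i)) =
   s.+1%:R / 2 * \sum_(0 <= i < s.+2) central_bin i * central_bin (s.+1 - i).
  by rewrite -h; apply: eq_bigr => i _; rewrite subSS mulrA -central_binS -mulrA.
have -> : \sum_(0 <= i < s.+1) (4 * i%:R + 2) * (central_bin i * central_bin (s - i))
   = 4 * \sum_(0 <= i < s.+1) i%:R * (central_bin i * central_bin (s - i))
   + 2 * \sum_(0 <= i < s.+1) central_bin i * central_bin (s - i).
  by rewrite !big_distrr /= -big_split /=; apply: eq_bigr => i _; ring.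
rewrite sum_central_bin_mull IH => h; apply: (mulfI n0).
by rewrite exprS -natr1 in h *; lra.
Qed.

Lemma sum_central_bin_mul (s : nat) :
  \sum_(0 <= i < s.+1) (i%:R * central_bin i) * ((s - i)%:R * central_bin (s - i))
  = 4 ^+ s * (s%:R * (s%:R - 1) / 8).
Proof.
elim: s => [|s IH]; first by rewrite big_nat1 !mul0r mulr0.
rewrite big_nat_recl //= !mul0r add0r.
have -> : \sum_(0 <= i < s.+1) i.+1%:R * central_bin i.+1 * ((s.+1 - i.+1)%:R * central_bin (s.+1 - i.+1))
   = 4 * \sum_(0 <= i < s.+1) i%:R * central_bin i * ((s - i)%:R * central_bin (s - i))
   + 2 * \sum_(0 <= i < s.+1) (s - i)%:R * (central_bin i * central_bin (s - i)).
  rewrite !big_distrr /= -big_split /=; apply: eq_bigr => i _.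
  by rewrite subSS central_binS -/(central_bin i); ring.
have -> : \sum_(0 <= i < s.+1) (s - i)%:R * (central_bin i * central_bin (s - i)) = s%:R / 2 * 4 ^+ s.
  rewrite -sum_central_bin -sum_central_bin_mull.
  rewrite (sum_rev_index (fun i j => i%:R * (central_bin i * central_bin j))).
  by apply: eq_bigr => i _; rewrite [central_bin i * _]mulrC.
by rewrite IH exprS -natr1; field.
Qed.

Lemma sum_central_bin_weight (s : nat) :
  \sum_(0 <= i < s.+1) central_bin i * central_bin (s - i)
     * (s.+1%:R^-1 - 4 * (i.+1%:R * (s - i).+1%:R) / (s.+1%:R * s.+2%:R))
  = - 4 ^+ s * (2^-1 + s.+2%:R^-1).
Proof.
transitivity ((s.+1%:R^-1 - 4 / s.+2%:R) *
     (\sum_(0 <= i < s.+1) central_bin i * central_bin (s - i))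
   - 4 / (s.+1%:R * s.+2%:R) *
     \sum_(0 <= i < s.+1) (i%:R * central_bin i) * ((s - i)%:R * central_bin (s - i))).
  rewrite !big_distrr /= -sumrN -big_split /=; apply: eq_big_nat => i /andP[_ h].
  have -> : i.+1%:R * (s - i).+1%:R = i%:R * (s - i)%:R + s.+1%:R :> rat.
    by rewrite -!natr1 (natrB _ (h : (i <= s)%N)); ring.
  by rewrite -!natr1; field; rewrite -?natrD !natr1 ?nat1r !pnatr_eq0.
rewrite sum_central_bin sum_central_bin_mul -!natr1.
by field; rewrite -?natrD !natr1 ?nat1r !pnatr_eq0.
Qed.

(** * Congruences in the p-integral rationals *)

Lemma ZlocP (p : nat) (r : rat) :
  r \in Zloc p <-> exists2 d : int, ~~ (p %| d)%Z & exists n : int, r = n%:~R / d%:~R.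
Proof.
split=> [hr|[d hd [n ->]]].
  by exists (denq r) => //; exists (numq r); rewrite divq_num_den.
have d0 : (d%:~R : rat) != 0.
  by rewrite intr_eq0; apply: contraNneq hd => ->; rewrite dvdz0.
rewrite inE; set q := (_ / _); apply: contra hd => /dvdz_trans; apply.
have e : numq q * d = n * denq q.
  by apply: (@intr_inj rat); rewrite !rmorphM /= numqE /q; field.
have : (denq q %| numq q * d)%Z by rewrite e dvdz_mull.
by rewrite Gauss_dvdzr // coprimezE coprime_sym; exact: coprime_num_den.
Qed.

Lemma Zloc_int (p : nat) (n : int) : prime p -> n%:~R \in Zloc p.
Proof.
move=> p_pr; rewrite inE denq_int dvdzE /=.
by rewrite dvdn1 neq_ltn prime_gt1 ?orbT.
Qed.

Lemma Zloc_nat (p n : nat) : prime p -> n%:R \in Zloc p.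
Proof. by move=> p_pr; rewrite -[n%:R]/(n%:~R) Zloc_int. Qed.

Lemma ZlocVint (p : nat) (d : int) : ~~ (p %| d)%Z -> d%:~R^-1 \in Zloc p.
Proof.
by move=> hd; apply/ZlocP; exists d => //; exists 1; rewrite mul1r.
Qed.

Lemma ZlocVnat (p d : nat) : ~~ (p %| d)%N -> d%:R^-1 \in Zloc p.
Proof. by move=> hd; rewrite -[d%:R]/(d%:~R) ZlocVint. Qed.

Lemma dvdz_prime_mul (p : nat) (a b : int) : prime p ->
  (p %| a * b)%Z = (p %| a)%Z || (p %| b)%Z.
Proof. by move=> p_pr; rewrite !dvdzE abszM Euclid_dvdM. Qed.

Lemma Zloc_opers (p : nat) (u v : rat) : prime p ->
  u \in Zloc p -> v \in Zloc p -> u + v \in Zloc p /\ u * v \in Zloc p.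
Proof.
move=> p_pr /ZlocP[d hd [n ->]] /ZlocP[d' hd' [n' ->]].
have nz (e : int) : ~~ (p %| e)%Z -> (e%:~R : rat) != 0.
  by move=> he; rewrite intr_eq0; apply: contraNneq he => ->; rewrite dvdz0.
have hdd : ~~ (p %| d * d')%Z by rewrite dvdz_prime_mul // negb_or hd.
have := nz _ hd; have := nz _ hd' => n0 n0'.
split; apply/ZlocP; exists (d * d') => //.
  by exists (n * d' + n' * d); rewrite rmorphD !rmorphM /=; field; rewrite n0.
by exists (n * n'); rewrite !rmorphM /=; field; rewrite n0.
Qed.

Lemma ZlocD (p : nat) (u v : rat) : prime p ->
  u \in Zloc p -> v \in Zloc p -> u + v \in Zloc p.
Proof. by move=> p_pr hu hv; case: (Zloc_opers _ _ _ p_pr hu hv). Qed.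

Lemma ZlocM (p : nat) (u v : rat) : prime p ->
  u \in Zloc p -> v \in Zloc p -> u * v \in Zloc p.
Proof. by move=> p_pr hu hv; case: (Zloc_opers _ _ _ p_pr hu hv). Qed.

Lemma ZlocN (p : nat) (u : rat) : prime p -> u \in Zloc p -> - u \in Zloc p.
Proof. by move=> p_pr hu; rewrite -mulN1r ZlocM // (Zloc_int _ (-1)). Qed.

Lemma ZlocX (p n : nat) (u : rat) : prime p -> u \in Zloc p -> u ^+ n \in Zloc p.
Proof.
move=> p_pr hu; elim: n => [|n IH]; first by rewrite (Zloc_nat _ 1).
by rewrite exprS ZlocM.
Qed.

Lemma Zloc_sum (p n : nat) (F : nat -> rat) : prime p ->
  (forall i, (i < n)%N -> F i \in Zloc p) -> \sum_(0 <= i < n) F i \in Zloc p.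
Proof.
move=> p_pr; elim: n => [|n IH] hF; first by rewrite big_nil (Zloc_nat _ 0).
by rewrite big_nat_recr //= ZlocD ?hF // IH // => i /ltnW; apply: hF.
Qed.

Lemma eqmod_loc_refl (p m : nat) (u : rat) : prime p -> eqmod_loc p m u u.
Proof. by move=> p_pr; exists 0; rewrite ?(Zloc_nat _ 0) // subrr mulr0. Qed.

Lemma eqmod_loc_trans (p m : nat) (v u w : rat) : prime p ->
  eqmod_loc p m u v -> eqmod_loc p m v w -> eqmod_loc p m u w.
Proof.
move=> p_pr [a ha ea] [b hb eb]; exists (a + b); first exact: ZlocD.
by rewrite mulrDr -ea -eb addrA subrK.
Qed.

Lemma eqmod_loc_sum (p m n : nat) (F G : nat -> rat) : prime p ->
  (forall i, (i < n)%N -> eqmod_loc p m (F i) (G i)) ->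
  eqmod_loc p m (\sum_(0 <= i < n) F i) (\sum_(0 <= i < n) G i).
Proof.
move=> p_pr; elim: n => [|n IH] h; first by rewrite !big_nil; exact: eqmod_loc_refl.
have [a ha ea] := h n (ltnSn n).
have [|b hb eb] := IH; first by move=> i /ltnW; apply: h.
exists (b + a); first exact: ZlocD.
by rewrite !big_nat_recr //= mulrDr -ea -eb; ring.
Qed.

(** The only multiple of [p] below [2p] is [p] itself, and [p / p = 1]. *)
Lemma Zloc_p_div (p d : nat) : prime p -> (0 < d < 2 * p)%N ->
  p%:R / d%:R \in Zloc p.
Proof.
move=> p_pr /andP[d0 d2].
have [/dvdnP[k e]|nd] := boolP (p %| d)%N; last by rewrite ZlocM ?ZlocVnat ?Zloc_nat.
have -> : d = p by move: d0 d2; rewrite e; case: (k) => [|[|k0]] //; lia.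
by rewrite divff ?(Zloc_nat _ 1) // pnatr_eq0 -lt0n prime_gt0.
Qed.

(** [p] divides [s!] but neither [m!] nor [(s-m)!]. *)
Lemma prime_dvd_bin_carry (p s m : nat) : prime p ->
  (m < p)%N -> (p <= s)%N -> (s < p + m)%N -> (p %| 'C(s, m))%N.
Proof.
move=> p_pr mp ps spm.
have nf k : (k < p)%N -> ~~ (p %| k`!)%N.
  elim: k => [|k IH] hk; first by rewrite fact0 dvdn1 neq_ltn prime_gt1 ?orbT.
  by rewrite factS Euclid_dvdM // negb_or IH 1?ltnW // gtnNdvd.
have : (p %| 'C(s, m) * (m`! * (s - m)`!))%N.
  by rewrite bin_fact ?dvdn_fact ?prime_gt0 // (leq_trans (ltnW mp)).
rewrite !Euclid_dvdM // (negPf (nf _ mp)) (negPf (nf (s - m)%N _)) ?orbF //; lia.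
Qed.

(** Passing from [m] to [m + 1] multiplies the left side by
    [(p^2 - (m+1)^2) / (m+1)^2], which is [-1] modulo [p^2]; the factor [p - m] is
    what gives the quotient this form. *)
Lemma shifted_coef_prime (p m : nat) : prime p -> (m < p)%N ->
  exists2 b, b \in Zloc p &
    (p%:R - m%:R) * (shifted_coef p m)%:R = p%:R * ((-1) ^+ m + p%:R ^+ 2 * b).
Proof.
move=> p_pr; elim: m => [|m IH] hm.
  exists 0; first exact: (Zloc_nat _ 0).
  by rewrite /shifted_coef !bin0; ring.
have [b hb e] := IH (ltnW hm).
have n0 : (m.+1%:R : rat) != 0 by rewrite pnatr_eq0.
exists (((-1) ^+ m + p%:R ^+ 2 * b) * (m.+1%:R^-1 * m.+1%:R^-1) - b).
  have hV : m.+1%:R^-1 \in Zloc p by apply: ZlocVnat; rewrite gtnNdvd.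
  rewrite ZlocD ?ZlocN // !ZlocM // ZlocD ?ZlocM ?ZlocX ?Zloc_nat //.
  exact: (Zloc_int _ (-1)).
have h := shifted_coefS p m.
have n2 : (m.+1%:R ^+ 2 : rat) != 0 by rewrite expf_neq0.
apply: (mulfI n2); rewrite mulrCA h.
transitivity ((p%:R - m.+1%:R) * (p%:R + m.+1%:R) * ((p%:R - m%:R) * (shifted_coef p m)%:R) : rat).
  by rewrite -!natr1; ring.
by rewrite e (exprS (-1)); field; rewrite nat1r.
Qed.

(** * Reduction of the sum modulo p^3 *)

(** The factor left from [sum_odd_cube_shifted_coef] at [n = p] after the term
    with [n^2] is discarded.  It is not always p-integral: its denominators contain
    [p] for [m = p - 2] and [m = p - 1]. *)
Definition weight (m : nat) : rat := m.+1%:R^-1 - 4 / m.+2%:R.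

Lemma Zloc_p_weight (p m : nat) : prime p -> (m < p)%N ->
  p%:R * weight m \in Zloc p.
Proof.
move=> p_pr hm; have p1 := prime_gt1 p_pr.
rewrite /weight mulrBr mulrCA; apply: ZlocD => //.
  by apply: Zloc_p_div => //; lia.
apply: ZlocN => //; apply: ZlocM => //; first exact: (Zloc_nat _ 4).
by apply: Zloc_p_div => //; lia.
Qed.

Lemma Zloc_sign (p m : nat) : prime p -> (-1) ^+ m \in Zloc p.
Proof. by move=> p_pr; apply: ZlocX => //; exact: (Zloc_int _ (-1)). Qed.

Lemma Zloc_quartic_coef (p n m : nat) (y : rat) : prime p -> y \in Zloc p ->
  quartic_coef n y m \in Zloc p.
Proof.
move=> p_pr hy; do 2 (apply: Zloc_sum => // ? _).
by rewrite !ZlocM ?ZlocX ?Zloc_nat.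
Qed.

(** The error terms are of relative size [p^2], so one factor [p] in a denominator
    of the weights leaves them divisible by [p^3]. *)
Lemma quartic_sum_weight (p : nat) (y : rat) : prime p -> y \in Zloc p ->
  eqmod_loc p 3
    (\sum_(0 <= m < p) p%:R * (p%:R - m%:R) * (shifted_coef p m)%:R *
     (m.+1%:R^-1 - 4 / m.+2%:R + 4 * p%:R ^+ 2 / m.+2%:R) * quartic_coef p y m)
    (\sum_(0 <= m < p) p%:R ^+ 2 * ((-1) ^+ m * weight m * quartic_coef p y m)).
Proof.
move=> p_pr hy; apply: eqmod_loc_sum => // m hm.
have [b hb e] := shifted_coef_prime _ _ p_pr hm.
have hw := Zloc_p_weight _ _ p_pr hm.
have hG := Zloc_quartic_coef p p m _ p_pr hy.
have hA : p%:R / m.+2%:R \in Zloc p.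
  by apply: Zloc_p_div => //; have := prime_gt1 p_pr; lia.
have h4 : 4 \in Zloc p by exact: (Zloc_nat _ 4).
have hs := Zloc_sign p m p_pr; have hp := Zloc_nat p p p_pr.
exists (quartic_coef p y m * ((-1) ^+ m * (4 * (p%:R / m.+2%:R)) + b * (p%:R * weight m)
   + 4 * b * (p%:R ^+ 2 * (p%:R / m.+2%:R)))).
  move: (p%:R / _) (p%:R * weight m) hA hw => A W hA hw.
  by rewrite ZlocM // !ZlocD // !ZlocM // ?ZlocX.
rewrite -[p%:R * _ * _]mulrA e /weight; ring.
Qed.

(** If [m < i] the coefficient is zero.  Otherwise [i + j - m < p], so that both
    [C(i+j,m)] and a central binomial coefficient acquire a factor [p], of which
    the weight can cancel at most one. *)
Lemma quartic_vanish (p i j m : nat) (y : rat) : prime p -> y \in Zloc p ->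
  (i < p)%N -> (j < p)%N -> (m < p)%N -> (p <= i + j)%N ->
  eqmod_loc p 3
    (p%:R ^+ 2 * ((-1) ^+ m * weight m * ((lin_coef i j m)%:R *
      (central_bin i * y ^+ i * (central_bin j * y ^+ j))))) 0.
Proof.
move=> p_pr hy hi hj hm hij.
have half k : (k < p)%N -> (p <= 2 * k)%N -> (p %| 'C(2 * k, k))%N.
  by move=> hk h; apply: prime_dvd_bin_carry => //; lia.
have [K eK] : exists K, (lin_coef i j m * ('C(2 * i, i) * 'C(2 * j, j)) = p ^ 2 * K)%N.
  have [him|] := leqP i m; last first.
    by move=> h; exists 0%N; rewrite /lin_coef (bin_small h) !muln0.
  have /dvdnP[K1 e1] : (p %| lin_coef i j m)%N.
    by rewrite /lin_coef !dvdn_mulr // prime_dvd_bin_carry //; lia.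
  have /dvdnP[K2 e2] : (p %| 'C(2 * i, i) * 'C(2 * j, j))%N.
    have [h|h] := leqP p (2 * i); first by rewrite dvdn_mulr ?half.
    by rewrite dvdn_mull ?half //; lia.
  by exists (K1 * K2)%N; rewrite e1 e2; lia.
exists (y ^+ i * y ^+ j * (-1) ^+ m * (p%:R * weight m) * K%:R).
  move: (p%:R * weight m) (Zloc_p_weight _ _ p_pr hm) => W hW.
  by rewrite !ZlocM ?Zloc_sign ?ZlocX ?Zloc_nat.
have {}eK : (lin_coef i j m)%:R * ('C(2 * i, i)%:R * 'C(2 * j, j)%:R)
    = p%:R ^+ 2 * K%:R :> rat by rewrite -natrX -!natrM eK.
rewrite subr0 /central_bin.
transitivity (p%:R ^+ 2 * ((-1) ^+ m * weight m) * y ^+ i * y ^+ j *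
  ((lin_coef i j m)%:R * ('C(2 * i, i)%:R * 'C(2 * j, j)%:R)) : rat); first by ring.
by rewrite eK; ring.
Qed.

Lemma sum_triangle (n : nat) (F : nat -> nat -> rat) :
  \sum_(0 <= s < n) \sum_(0 <= i < s.+1) F i (s - i)%N
  = \sum_(0 <= i < n) \sum_(0 <= j < n) if (i + j < n)%N then F i j else 0.
Proof.
elim: n => [|n IH]; first by rewrite !big_nil.
rewrite big_nat_recr //= IH.
have -> : \sum_(0 <= i < n.+1) F i (n - i)%N
  = \sum_(0 <= i < n.+1) \sum_(0 <= j < n.+1) if (i + j == n)%N then F i j else 0.
  apply: eq_big_nat => i /andP[_ hi].
  rewrite (bigD1_seq (n - i)%N) ?mem_index_iota ?iota_uniq //=; last by lia.
  rewrite subnKC // eqxx big1 ?addr0 // => j hj.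
  by case: eqP => // e; case/eqP: hj; lia.
have -> : \sum_(0 <= i < n) \sum_(0 <= j < n) (if (i + j < n)%N then F i j else 0)
  = \sum_(0 <= i < n.+1) \sum_(0 <= j < n.+1) if (i + j < n)%N then F i j else 0.
  rewrite [RHS]big_nat_recr //= [X in _ = _ + X]big1 ?addr0; last first.
    by move=> j _; rewrite ltnNge leq_addr.
  apply: eq_bigr => i _; rewrite [RHS]big_nat_recr //=.
  by rewrite [(i + n < n)%N]ltnNge leq_addl addr0.
rewrite -big_split; apply: eq_bigr => i _; rewrite -big_split; apply: eq_bigr => j _ /=.
by rewrite [(i + j < n.+1)%N]ltnS; case: (ltngtP (i + j)%N n); rewrite ?addr0 ?add0r.
Qed.

(** Once the terms with [p <= i + j] are dropped, grouping the others by
    [s = i + j] makes the inner sum over [m] complete, since [m <= s < p]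
    wherever [lin_coef i j m] is nonzero. *)
Lemma quartic_weight_closed (p : nat) (y : rat) : prime p -> y \in Zloc p ->
  eqmod_loc p 3
    (\sum_(0 <= m < p) p%:R ^+ 2 * ((-1) ^+ m * weight m * quartic_coef p y m))
    (- p%:R ^+ 2 * \sum_(0 <= s < p) (- (4 * y)) ^+ s * (2^-1 + s.+2%:R^-1)).
Proof.
move=> p_pr hy.
pose T i j m : rat := p%:R ^+ 2 * ((-1) ^+ m * weight m * ((lin_coef i j m)%:R *
      (central_bin i * y ^+ i * (central_bin j * y ^+ j)))).
have -> : \sum_(0 <= m < p) p%:R ^+ 2 * ((-1) ^+ m * weight m * quartic_coef p y m)
  = \sum_(0 <= i < p) \sum_(0 <= j < p) \sum_(0 <= m < p) T i j m.
  under [RHS]eq_bigr => i _ do rewrite exchange_big_nat.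
  rewrite [RHS]exchange_big_nat /=; apply: eq_bigr => m _.
  rewrite /quartic_coef !big_distrr /=; apply: eq_bigr => i _.
  by rewrite !big_distrr.
have -> : - p%:R ^+ 2 * \sum_(0 <= s < p) (- (4 * y)) ^+ s * (2^-1 + s.+2%:R^-1)
  = \sum_(0 <= i < p) \sum_(0 <= j < p)
      if (i + j < p)%N then \sum_(0 <= m < p) T i j m else 0.
  rewrite -(sum_triangle _ (fun i j => \sum_(0 <= m < p) T i j m)) big_distrr /=.
  apply: eq_big_nat => s /andP[_ hs].
  transitivity (p%:R ^+ 2 * (- y) ^+ s * (- 4 ^+ s * (2^-1 + s.+2%:R^-1)) : rat).
    by rewrite -[- (4 * y)]mulrN exprMn; ring.
  rewrite -sum_central_bin_weight big_distrr; apply: eq_big_nat => i /andP[_ hi] /=.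
  transitivity (p%:R ^+ 2 * (central_bin i * y ^+ i * (central_bin (s - i) * y ^+ (s - i))) *
     \sum_(0 <= m < p) (-1) ^+ m * (lin_coef i (s - i) m)%:R * (m.+1%:R^-1 - 4 / m.+2%:R)).
    rewrite alt_sum_lin_coef_weight subnKC // (exprNn y).
    have -> : y ^+ s = y ^+ i * y ^+ (s - i) by rewrite -exprD subnKC.
    by ring.
  by rewrite big_distrr /=; apply: eq_bigr => m _; rewrite /T /weight; ring.
apply: eqmod_loc_sum => // i hi; apply: eqmod_loc_sum => // j hj.
case: ltnP => hij; first exact: eqmod_loc_refl.
have := eqmod_loc_sum p 3 p (T i j) (fun=> 0) p_pr
  (fun m hm => quartic_vanish _ _ _ _ _ p_pr hy hi hj hm hij).
by rewrite [X in eqmod_loc _ _ _ X]big1.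
Qed.

(** * Evaluation of the truncated logarithm *)

Lemma fermat_little_int (p : nat) (z : int) : prime p -> (p %| z ^+ p - z)%Z.
Proof.
move=> p_pr; rewrite (dvdz_pcharf (pchar_Fp p_pr)) rmorphB rmorphXn /=.
by rewrite -[X in _ ^+ X](card_Fp p_pr) expf_card subrr.
Qed.

Lemma fermat_quotient_int (p : nat) (z : int) : prime p -> ~~ (p %| z)%Z ->
  exists q : int, fermat_quotient p z = q%:~R.
Proof.
move=> p_pr hz; have := fermat_little_int p z p_pr.
have -> : z ^+ p - z = z * (z ^+ p.-1 - 1).
  by rewrite mulrBr mulr1 -exprS prednK ?prime_gt0.
rewrite dvdz_prime_mul // (negPf hz) => /dvdzP[q e]; exists q.
by rewrite /fermat_quotient e rmorphM /= mulfK // pnatr_eq0 -lt0n prime_gt0.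
Qed.

(** Passing from [m] to [m + 1] multiplies the binomial by
    [(p - (m+1)) / (m+1)], which is [-1] modulo [p]. *)
Lemma bin_pred_prime (p m : nat) : prime p -> (m < p)%N ->
  exists2 b, b \in Zloc p & 'C(p.-1, m)%:R = (-1) ^+ m + p%:R * b :> rat.
Proof.
move=> p_pr; have p0 := prime_gt0 p_pr.
have pE : (p.-1%:R = p%:R - 1 :> rat) by rewrite -[in RHS](prednK p0) -natr1 addrK.
elim: m => [|m IH] hm.
  by exists 0; [exact: (Zloc_nat _ 0) | rewrite bin0 mulr0 addr0].
have [b hb e] := IH (ltnW hm).
have n0 : (m.+1%:R : rat) != 0 by rewrite pnatr_eq0.
exists (((-1) ^+ m + p%:R * b) * m.+1%:R^-1 - b).
  rewrite ZlocD ?ZlocN // ZlocM ?ZlocVnat ?gtnNdvd // ZlocD ?Zloc_sign //.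
  by rewrite ZlocM ?Zloc_nat.
apply: (mulfI n0); rewrite natrB_bin e pE (exprS (-1)).
by rewrite -!natr1 in n0 *; field.
Qed.

(** [C(p,r) = (p/r) C(p-1,r-1)], and [C(p-1,r-1)] is [(-1)^(r-1)] modulo [p]. *)
Lemma truncated_log (p : nat) (z : rat) : prime p -> z \in Zloc p ->
  eqmod_loc p 1 (\sum_(1 <= r < p) (- z) ^+ r / r%:R)
    (- (((1 + z) ^+ p - 1 - z ^+ p) / p%:R)).
Proof.
move=> p_pr hz; have p0 := prime_gt0 p_pr; have p1 := prime_gt1 p_pr.
have np : (p%:R : rat) != 0 by rewrite pnatr_eq0 -lt0n.
have -> : (1 + z) ^+ p - 1 - z ^+ p = \sum_(1 <= r < p) 'C(p, r)%:R * z ^+ r.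
  have -> : (1 + z) ^+ p = \sum_(0 <= r < p.+1) 'C(p, r)%:R * z ^+ r.
    rewrite exprDn big_mkord; apply: eq_bigr => r _.
    by rewrite expr1n mul1r mulr_natl.
  rewrite big_nat_recr //= big_ltn // bin0 binn; ring.
rewrite big_distrl -sumrN !big_add1 -(prednK p0) /= (prednK p0).
apply: eqmod_loc_sum => // r hr.
have hrp : (r.+1 < p)%N by lia.
have [b hb e] := bin_pred_prime p r p_pr (ltnW hrp).
have n0 : (r.+1%:R : rat) != 0 by rewrite pnatr_eq0.
exists (z ^+ r.+1 * b * r.+1%:R^-1).
  by rewrite !ZlocM ?ZlocX ?ZlocVnat ?gtnNdvd.
have eC : 'C(p, r.+1)%:R = p%:R * ((-1) ^+ r + p%:R * b) / r.+1%:R :> rat.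
  apply: (mulfI n0); rewrite [RHS]mulrCA mulfV // mulr1 -e -!natrM.
  by rewrite -mul_bin_diag.
rewrite eC (exprNn z) (exprS (-1)).
by rewrite -!natr1 in n0 *; field; rewrite np n0.
Qed.

(** With [q] the Fermat quotient, [(1+z)^p = (1+z) (1+pq)^2], and the truncated
    logarithm of [1+z] yields the term in [q].  Of the two boundary terms,
    [-z^p/p] cancels against the one from [truncated_log], and [z^(p+1)/(p+1)] is
    [z^2] modulo [p]. *)
Lemma truncated_sum_eval (p : nat) (z q t : rat) : prime p -> (2 < p)%N ->
  z \in Zloc p -> z^-1 \in Zloc p -> z != 0 ->
  (1 + z)^-1 \in Zloc p -> 1 + z != 0 ->
  q \in Zloc p -> 1 + z = t ^+ 2 -> t ^+ p.-1 = 1 + p%:R * q ->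
  (exists2 w, w \in Zloc p & z ^+ p - z = p%:R * w) ->
  eqmod_loc p 3
    (- p%:R ^+ 2 * \sum_(0 <= s < p) (- z) ^+ s * (2^-1 + s.+2%:R^-1))
    (p%:R / z - p%:R ^+ 2 / z * (- (2 * (1 + z) * q / z) + 3 * z / 2 + 1)).
Proof.
move=> p_pr p2 hz hVz z0 hV1z z10 hq ezt et [w hw ew].
have p0 := prime_gt0 p_pr; have p1 := prime_gt1 p_pr.
have np : (p%:R : rat) != 0 by rewrite pnatr_eq0 -lt0n.
have np1 : (p.+1%:R : rat) != 0 by rewrite pnatr_eq0.
have podd : odd p by case: (even_prime p_pr) p2 => [->|].
have sgnp : (-1) ^+ p = -1 :> rat by rewrite -signr_odd podd.
have [d hd ed] := truncated_log p z p_pr hz.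
set L := \sum_(1 <= r < p) (- z) ^+ r / r%:R in ed.
set sg := \sum_(0 <= s < p) (- z) ^+ s.
set tau := \sum_(0 <= s < p) (- z) ^+ s / s.+2%:R.
have sgE : (1 + z) * sg = 1 + z ^+ p.
  have := subrX1 (- z) p; rewrite (exprNn z) sgnp mulN1r => h.
  by rewrite /sg big_mkord; lra.
(* The indices [r = s + 2] run over [2 <= r <= p + 1]: the term [r = 1] is
   missing and those for [p] and [p + 1] are extra. *)
have tauE : z ^+ 2 * tau = L + z - z ^+ p / p%:R + z ^+ p.+1 / p.+1%:R.
  have -> : z ^+ 2 * tau = \sum_(2 <= r < p.+2) (- z) ^+ r / r%:R.
    rewrite !big_add1 /= big_distrr; apply: eq_bigr => s _ /=.
    by rewrite mulrA; congr (_ / _); rewrite !exprS expr0; ring.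
  rewrite !big_nat_recr //= 1?ltnW // /L [in RHS]big_ltn // !(exprNn z) sgnp (exprS (-1)) sgnp.
  by rewrite expr1; field; rewrite np nat1r np1.
have powE : (1 + z) ^+ p = (1 + z) * (1 + p%:R * q) ^+ 2.
  by rewrite -{1}(prednK p0) exprS -et -exprM mulnC exprM -ezt.
have -> : \sum_(0 <= s < p) (- z) ^+ s * (2^-1 + s.+2%:R^-1) = sg / 2 + tau.
  by rewrite /sg /tau big_distrl -big_split /=; apply: eq_bigr => s _; rewrite mulrDr.
have sgE' : sg = 1 + p%:R * (w * (1 + z)^-1).
  apply: (mulfI z10); rewrite sgE; move: ew => /eqP; rewrite subr_eq => /eqP ->.
  by field.
pose ep := w * z * p.+1%:R^-1 - z ^+ 2 * p.+1%:R^-1.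
have epE : z ^+ p.+1 / p.+1%:R = z ^+ 2 + p%:R * ep.
  rewrite exprS; move: ew => /eqP; rewrite subr_eq => /eqP ->.
  by rewrite /ep -natr1 in np1 *; field.
have tauE' : tau = z^-1 * z^-1 * (z + z ^+ 2 + p%:R * d + p%:R * ep
     - ((1 + z) * (1 + p%:R * q) ^+ 2 - 1) / p%:R).
  have z2 : z ^+ 2 != 0 by rewrite expf_neq0.
  apply: (mulfI z2); rewrite tauE epE -powE.
  have -> : L = p%:R * d - ((1 + z) ^+ p - 1 - z ^+ p) / p%:R.
    by move: ed; rewrite expr1 => <-; ring.
  by field; rewrite z0 np.
have hVp1 : p.+1%:R^-1 \in Zloc p.
  apply: ZlocVnat; rewrite -addn1 dvdn_addr // dvdn1 neq_ltn p1 orbT //.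
have hV2 : 2^-1 \in Zloc p by apply: (ZlocVnat p 2); rewrite gtnNdvd.
have hep : ep \in Zloc p.
  by rewrite ZlocD ?ZlocN // !ZlocM // ZlocX.
exists (- (w * (1 + z)^-1 * 2^-1) - z^-1 * z^-1 * (d + ep - (1 + z) * (q * q))).
  have h1 : 1 + z \in Zloc p by rewrite ZlocD ?(Zloc_nat _ 1).
  apply: ZlocD => //; apply: ZlocN => //; first by rewrite !ZlocM.
  apply: ZlocM => //; first exact: ZlocM.
  by apply: ZlocD => //; [exact: ZlocD | rewrite ZlocN // !ZlocM].
by rewrite sgE' tauE'; field; rewrite z0 z10 np.
Qed.

Theorem corollary2 (p : nat) (x : int) (p_prime : prime p) (p_gt3 : (3 < p)%N)
    (p_ndvd : ~~ (p %| x * (x + 1) * (2 * x + 1))%Z) :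
  let t : rat := x%:~R in
  eqmod_loc p 3
    (\sum_(0 <= k < p)
       (2 * k + 1)%N%:R ^+ 3 * (legendre k).[2 * t + 1] ^+ 4)
    (p%:R / (4 * t * (t + 1))
     - p%:R ^+ 2 / (4 * t * (t + 1))
       * (- ((2 * t + 1) ^+ 2 * fermat_quotient p (2 * x + 1)
             / (2 * t * (t + 1)))
          + 6 * (t ^+ 2 + t) + 1)).
Proof.
move=> t; have p1 := prime_gt1 p_prime.
pose y : rat := t * (t + 1).
have hy : y \in Zloc p.
  have -> : y = (x * (x + 1))%:~R by rewrite rmorphM rmorphD.
  exact: Zloc_int.
have [hx hx1 h2x1] : [/\ ~~ (p %| x)%Z, ~~ (p %| x + 1)%Z & ~~ (p %| 2 * x + 1)%Z].
  by move: p_ndvd; rewrite !dvdz_prime_mul // !negb_or => /andP[/andP[-> ->] ->].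
have nz (d : int) : ~~ (p %| d)%Z -> (d%:~R : rat) != 0.
  by move=> hd; rewrite intr_eq0; apply: contraNneq hd => ->; rewrite dvdz0.
have h4 : ~~ (p %| 4)%Z.
  have := dvdz_prime_mul p 2 2 p_prime; rewrite -[(2 * 2)%R]/(4 : int) => ->.
  by rewrite orbb dvdzE gtnNdvd //= ltnW.
pose zi : int := 4 * (x * (x + 1)); pose z : rat := 4 * y.
have xE : (x + 1)%:~R = t + 1 :> rat by rewrite rmorphD.
have zE : z = zi%:~R by rewrite /z /y /zi intrM intrM xE.
have hzi : ~~ (p %| zi)%Z by rewrite /zi !dvdz_prime_mul // !negb_or h4 hx.
have z1E : 1 + z = ((2 * x + 1) ^+ 2)%:~R.
  by rewrite /z /y rmorphXn rmorphD rmorphM /= -/t; ring.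
have hz1 : ~~ (p %| (2 * x + 1) ^+ 2)%Z by rewrite expr2 dvdz_prime_mul // negb_or h2x1.
have [q eq] := fermat_quotient_int p (2 * x + 1) p_prime h2x1.
have p0 : (p%:R : rat) != 0 by rewrite pnatr_eq0 -lt0n ltnW.
rewrite (sum_legendre_quartic t p).
apply: eqmod_loc_trans (quartic_sum_weight p y p_prime hy) _ => //.
apply: eqmod_loc_trans (quartic_weight_closed p y p_prime hy) _ => //.
have e1 : 1 + z = (2 * t + 1) ^+ 2 by rewrite /z /y; ring.
have z0 : z != 0 by rewrite zE nz.
have [t0 t10] : t != 0 /\ t + 1 != 0.
  by split; rewrite ?nz // -[1]/(1%:~R) -rmorphD nz.
have := truncated_sum_eval p z q%:~R (2 * t + 1) p_prime.
rewrite -eq.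
have -> : p%:R / z - p%:R ^+ 2 / z *
    (- (2 * (1 + z) * fermat_quotient p (2 * x + 1) / z) + 3 * z / 2 + 1)
  = p%:R / (4 * t * (t + 1))
     - p%:R ^+ 2 / (4 * t * (t + 1))
       * (- ((2 * t + 1) ^+ 2 * fermat_quotient p (2 * x + 1)
             / (2 * t * (t + 1)))
          + 6 * (t ^+ 2 + t) + 1).
  by rewrite e1 /z /y; field; rewrite t0 t10.
apply => //.
- exact: ltnW.
- by rewrite zE Zloc_int.
- by rewrite zE ZlocVint.
- by rewrite z1E ZlocVint.
- by rewrite z1E nz.
- by rewrite eq Zloc_int.
- rewrite /fermat_quotient rmorphB rmorphXn rmorphD rmorphM /= -/t; field.
  exact: p0.
have /dvdzP[w ew] := fermat_little_int p zi p_prime.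
exists w%:~R; first exact: Zloc_int.
by rewrite zE -rmorphXn -rmorphB ew rmorphM mulrC.
Qed.
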